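(* Let $\tau\in\mathbb{R}$ and let $\delta_{\psi,\omega}(\cdot-\tau)\in\mathcal{S}'_{\psi,\omega}$ be the weighted Dirac delta concentrated at $\tau$, defined by $$(\delta_{\psi,\omega}(\cdot-\tau),\phi)_{\psi,\omega}=\phi(\tau)\qquad\text{for all }\phi\in\mathcal{S}_{\psi,\omega}.$$ Then this distribution has the explicit representation in terms of the standard Dirac delta $\delta$: $$\delta_{\psi,\omega}(t-\tau)=\frac{1}{\omega(\tau)^2\psi'(\tau)}\,\delta(t-\tau).$$
   Context: Standing assumptions: $\psi:\mathbb{R}\to\mathbb{R}$ is a $C^\infty$-diffeomorphism, strictly increasing, with $\psi'(t)>0$ for all $t\in\mathbb{R}$; $\omega:\mathbb{R}\to(0,\infty)$ is $C^\infty$, and $\omega$ and all its derivatives have at most polynomial growth. Put $(T\phi)(y)=\omega(\psi^{-1}(y))\,\phi(\psi^{-1}(y))$. The weighted derivative is $\mathfrak{D}_{\psi,\omega}\phi(t)=\frac{1}{\omega(t)\psi'(t)}\frac{d}{dt}\big(\omega(t)\phi(t)\big)$. The weighted Schwartz space $\mathcal{S}_{\psi,\omega}$ is the space of all $\phi\in C^\infty(\mathbb{R})$ such that $\sup_{t\in\mathbb{R}}\big|\psi(t)^k\,\omega(t)\,\mathfrak{D}_{\psi,\omega}^m\phi(t)\big|<\infty$ for all $k,m\in\mathbb{N}_0$, with the topology generated by these seminorms (equivalently, $T\phi\in\mathcal{S}(\mathbb{R})$, with the transported topology). $\mathcal{S}'_{\psi,\omega}$ is its topological dual, and $(\cdot,\cdot)_{\psi,\omega}$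 is the duality pairing, compatible with $T$ in the sense that $(u,\phi)_{\psi,\omega}=\langle Tu,T\phi\rangle$, where $\langle\cdot,\cdot\rangle$ is the standard (bilinear) distributional pairing on $\mathbb{R}$. Generalized functions are identified with elements of $\mathcal{S}'_{\psi,\omega}$ through the weighted measure $\omega(t)^2\psi'(t)\,dt$: a generalized function $D$ acts by $(D,\phi)_{\psi,\omega}=\int_{\mathbb{R}}D(t)\phi(t)\,\omega(t)^2\psi'(t)\,dt$. When $D$ is an ordinary distribution of compact support, such as a multiple of $\delta(\cdot-\tau)$, this means $(D,\phi)_{\psi,\omega}=\langle D,\ \phi\,\omega^2\psi'\rangle$. Here $\delta(\cdot-\tau)$ is the ordinary Dirac delta, $\langle\delta(\cdot-\tau),g\rangle=g(\tau)$. The equality in the lemma is equality of elements of $\mathcal{S}'_{\psi,\omega}$ under this identification. *)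

(* Defs.v *)
From HB Require Import structures.
From mathcomp Require Import all_boot all_order all_algebra.
From mathcomp Require Import finmap complex.
From mathcomp Require Import all_classical all_reals all_analysis.

Set Implicit Arguments.
Unset Strict Implicit.
Unset Printing Implicit Defensive.

Import Order.TTheory GRing.Theory Num.Theory.
Import numFieldNormedType.Exports.

Local Open Scope ring_scope.
Local Open Scope complex_scope.
Local Open Scope classical_set_scope.

(* Complex-valued functions of a real variable are differentiated as functions
   R -> Rcomplex R, where Rcomplex R is R[i] seen as a normed module over R;
   the function spaces below are modules over the field R[i]. *)
Section Rcomplex_normedModType.
Variable R : realType.

HB.instance Definition _ := PseudoMetric.copy (Rcomplex R)
  (pseudoMetric_normed (Rcomplex R)).
HB.instance Definition _ := isPointed.Build (Rcomplex R) 0.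
HB.instance Definition _ :=
  NormedZmod_PseudoMetric_eq.Build R (Rcomplex R) erefl.

Lemma Rcomplex_normrZ (l : R) (x : Rcomplex R) : `|l *: x| = `|l| * `|x|.
Proof.
case: x => a b; rewrite /Num.norm/= /GRing.scale/=.
by rewrite !exprMn -mulrDr sqrtrM ?sqr_ge0// sqrtr_sqr.
Qed.

HB.instance Definition _ :=
  PseudoMetricNormedZmod_Lmodule_isNormedModule.Build R (Rcomplex R)
    Rcomplex_normrZ.

Lemma Rcomplex_normrM (x y : Rcomplex R) : `|(x * y : Rcomplex R)| = `|x| * `|y|.
Proof. exact: Normc.normcM. Qed.

Lemma Rcomplex_normE (x : Rcomplex R) :
  ((`|x| : R)%:C : R[i]) = `|x : R[i]|.
Proof. by case: x. Qed.

Lemma Rcomplex_scaleE (k : R) (x : Rcomplex R) :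
  k *: x = k%:C * x.
Proof.
case: x => a b; rewrite /GRing.scale /GRing.mul /=.
by rewrite !mul0r subr0 addr0.
Qed.

Lemma gt0_complex (e : R[i]) : 0 < e -> exists2 d : R, 0 < d & e = d%:C.
Proof.
case: e => a b; rewrite ltcE/= => /andP[/eqP b0 a0].
by exists a => //; rewrite b0.
Qed.

End Rcomplex_normedModType.

Section smooth.
Context {R : realType}.

Definition smooth (V : normedModType R) (f : R -> V) :=
  forall n t, derivable (f^`(n)) t 1.

Section theory.
Variable V : normedModType R.
Implicit Types f g : R -> V.

(* [f] is [n.+1] times differentiable *)
Fixpoint diffn (W : normedModType R) n (f : R -> W) : Prop :=
  (forall t, derivable f t 1) /\
  (if n is m.+1 then diffn m f^`() else True).

Lemma diffn_derivable n f : diffn n f -> forall t, derivable f t 1.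
Proof. by case: n => [|n] []. Qed.

Lemma diffnW n f : diffn n.+1 f -> diffn n f.
Proof.
elim: n f => [|n IHn] f [df ddf]; first by split.
by split=> //; apply: IHn.
Qed.

Lemma smoothP f : smooth f <-> forall n, diffn n f.
Proof.
split=> [sf n|sf n].
  elim: n f sf => [|n IHn] f sf; first by split=> // t; exact: (sf 0%N t).
  split; first by move=> t; exact: (sf 0%N t).
  by apply: IHn => m t; rewrite -derive1Sn; exact: sf.
elim: n f sf => [|n IHn] f sf t; first exact: diffn_derivable (sf 0%N) t.
by rewrite derive1Sn; apply: IHn => m; have [] := sf m.+1.
Qed.

Lemma smooth_derivable f : smooth f -> forall t, derivable f t 1.
Proof. by move=> sf t; exact: (sf 0%N t). Qed.

Lemma smooth_derive1 f : smooth f -> smooth f^`().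
Proof. by move=> sf n t; rewrite -derive1Sn; exact: sf. Qed.

Lemma derive1D f g : (forall t, derivable f t 1) ->
  (forall t, derivable g t 1) -> (f \+ g)^`() = f^`() \+ g^`().
Proof.
by move=> df dg; apply/funext => t; rewrite /= !derive1E; exact: deriveD.
Qed.

Lemma diffnD n f g : diffn n f -> diffn n g -> diffn n (f \+ g).
Proof.
elim: n f g => [|n IHn] f g [df ddf] [dg ddg]; split=> //.
- by move=> t; exact: derivableD.
- by move=> t; exact: derivableD.
- by rewrite derive1D//; exact: IHn.
Qed.

Lemma smoothD f g : smooth f -> smooth g -> smooth (f \+ g).
Proof.
by move=> /smoothP sf /smoothP sg; apply/smoothP => n; exact: diffnD.
Qed.

Lemma derive1nD f g n : smooth f -> smooth g ->
  (f \+ g)^`(n) = f^`(n) \+ g^`(n).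
Proof.
elim: n f g => [//|n IHn] f g sf sg.
rewrite !derive1Sn derive1D; [|exact: smooth_derivable..].
by apply: IHn; exact: smooth_derive1.
Qed.

Lemma smooth0 : smooth (cst 0 : R -> V).
Proof.
have d0 : (cst 0 : R -> V)^`() = cst 0.
  by apply/funext => t; rewrite derive1_cst.
move=> n; elim: n => [|n IHn] t; first exact: derivable_cst.
by rewrite derive1Sn d0.
Qed.

End theory.

Section scale.
Variable V : normedModType R.
Implicit Types (f : R -> V) (a : R -> R).

Lemma der_scale a f t : derivable a t 1 -> derivable f t 1 ->
  (fun h => h^-1 *: (((fun s => a s *: f s) \o shift t) (h *: 1) - a t *: f t))
  @ 0^' --> a t *: 'D_1 f t + 'D_1 a t *: f t.
Proof.
move=> da df.
evar (k : R -> V); rewrite [X in X @ _](_ : _ = k) /=; last first.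
  rewrite funeqE => h.
  have -> : a (h *: 1 + t) *: f (h *: 1 + t) - a t *: f t =
    a (h *: 1 + t) *: (f (h *: 1 + t) - f t) + (a (h *: 1 + t) - a t) *: f t.
    by rewrite scalerBr scalerBl addrA subrK.
  rewrite scalerDr scalerA mulrC -scalerA [_ *: ((_ - _) *: f t)]scalerA.
  by rewrite /k.
apply: cvgD.
  apply: (@cvgZ R V); last exact: df.
  suff : {for 0, continuous (fun h : R => a (h *: 1 + t))}.
    by move=> /continuous_withinNx; rewrite scale0r add0r.
  exact/differentiable_continuous/derivable1_diffP/(derivable1P _ _ _).1.
by apply: cvgZr_tmp; exact: da.
Qed.

Lemma derivable_scale a f t : derivable a t 1 -> derivable f t 1 ->
  derivable (fun s => a s *: f s) t 1.
Proof.
by move=> da df; apply/cvg_ex; eexists; exact: der_scale.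
Qed.

Lemma derive1_scale a f : (forall t, derivable a t 1) ->
  (forall t, derivable f t 1) ->
  (fun s => a s *: f s)^`() =
  (fun s => a s *: derive1 f s) \+ (fun s => derive1 a s *: f s).
Proof.
move=> da df; apply/funext => t; rewrite /= !derive1E.
exact: cvg_lim (der_scale (da t) (df t)).
Qed.

Lemma diffn_scale n a f : diffn n a -> diffn n f ->
  diffn n (fun s => a s *: f s).
Proof.
elim: n a f => [|n IHn] a f na nf.
  split=> // t; apply: derivable_scale; first by case: na.
  by case: nf.
have [da dda] := na; have [df ddf] := nf.
split; first by move=> t; exact: derivable_scale.
rewrite derive1_scale//; apply: diffnD; apply: IHn => //.
- exact: diffnW.
- exact: diffnW.
Qed.

Lemma smooth_scale a f : smooth a -> smooth f -> smooth (fun s => a s *: f s).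
Proof.
by move=> /smoothP sa /smoothP sf; apply/smoothP => n; exact: diffn_scale.
Qed.

Lemma smooth_continuous f : smooth f -> continuous f.
Proof.
move=> sf t; apply/differentiable_continuous/derivable1_diffP.
exact: smooth_derivable.
Qed.

End scale.

Lemma smoothM (a b : R -> R) : smooth a -> smooth b ->
  smooth (fun s => a s * b s).
Proof. exact: (@smooth_scale R). Qed.

Lemma derive1_inv (a : R -> R) : (forall t, a t != 0) ->
  (forall t, derivable a t 1) ->
  (fun s => (a s)^-1)^`() = (fun s => - derive1 a s * ((a s)^-1 * (a s)^-1)).
Proof.
move=> a0 da; apply/funext => t; rewrite !derive1E deriveV//.
by rewrite expr2 invfM scaleNr /GRing.scale/= mulrC mulNr.
Qed.

Lemma diffn_opp n (a : R -> R) : diffn n a -> diffn n (fun t => - a t).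
Proof.
elim: n a => [|n IHn] a [da dda].
  by split=> // t; exact: derivableN.
split; first by move=> t; exact: derivableN.
have -> : (fun t => - a t)^`() = (fun t => - derive1 a t).
  by apply/funext => t; rewrite !derive1E deriveN.
exact: IHn.
Qed.

Lemma smoothV (a : R -> R) : (forall t, a t != 0) -> smooth a ->
  smooth (fun s => (a s)^-1).
Proof.
move=> a0 /smoothP sa; apply/smoothP; elim=> [|n IHn].
  by split=> // t; apply: derivableV => //; have [] := sa 0%N.
split; first by move=> t; apply: derivableV => //; have [] := sa 0%N.
rewrite derive1_inv//; last by have [] := sa 0%N.
apply: (@diffn_scale R); last exact: (@diffn_scale R).
by apply: diffn_opp; have [] := sa n.+1.
Qed.

Section mulc.
Implicit Types (c : Rcomplex R) (f : R -> Rcomplex R).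

Lemma der_mulc c f t : derivable f t 1 ->
  (fun h => h^-1 *: (((fun s => c * f s : Rcomplex R) \o shift t) (h *: 1) - (c * f t : Rcomplex R)))
  @ 0^' --> (c * 'D_1 f t : Rcomplex R).
Proof.
move=> df.
rewrite [X in X @ _](_ : _ = (fun x => c * x : Rcomplex R) \o
  (fun h => h^-1 *: ((f \o shift t) (h *: 1) - f t))); last first.
  apply/funext => h /=.
  by rewrite -mulrBr !Rcomplex_scaleE mulrCA.
apply: (cvg_comp _ _ df).
apply/cvgrPdist_le => e e0; near=> x.
rewrite -mulrBr Rcomplex_normrM.
have c1 : 0 < `|c| + 1 by rewrite ltr_wpDl.
rewrite (@le_trans _ _ ((`|c| + 1) * (e / (`|c| + 1))))//; last first.
  by rewrite mulrCA mulfV ?mulr1// gt_eqF.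
apply: ler_pM => //; first by rewrite lerDl.
near: x; apply: cvgr_dist_le => //; exact: divr_gt0.
Unshelve. all: by end_near. Qed.

Lemma derive1_mulc c f : (forall t, derivable f t 1) ->
  (fun s => c * f s : Rcomplex R)^`() = (fun s => c * derive1 f s : Rcomplex R).
Proof.
move=> df; apply/funext => t; rewrite !derive1E.
exact: cvg_lim (der_mulc (df t)).
Qed.

Lemma smooth_mulc c f : smooth f -> smooth (fun s => c * f s : Rcomplex R).
Proof.
move=> sf n; elim: n f sf => [|n IHn] f sf t.
  by apply/cvg_ex; eexists; apply: der_mulc; exact: smooth_derivable.
rewrite derive1Sn derive1_mulc; last exact: smooth_derivable.
by apply: IHn; exact: smooth_derive1.
Qed.

Lemma derive1n_mulc c f n : smooth f ->
  (fun s => c * f s : Rcomplex R)^`(n) = (fun s => c * derive1n n f s : Rcomplex R).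
Proof.
elim: n f => [//|n IHn] f sf.
rewrite !derive1Sn derive1_mulc; last exact: smooth_derivable.
by apply: IHn; exact: smooth_derive1.
Qed.

End mulc.
End smooth.

Section seminorm_topology.
Context {R : realType} {V : zmodType} {I : Type}.

(* The seminorms take values in \bar R so that they can be written as suprema
   before these are known to be finite. *)
Definition seminorm_ball (p : I -> V -> \bar R) i (x : V) (e : R) : set V :=
  [set y | (p i (y - x)%R < e%:E)%E].

Definition seminorm_subbase (p : I -> V -> \bar R) : set (set V) :=
  [set A | exists i x e, 0 < e /\ A = seminorm_ball p i x e].

Definition seminorm_topology (p : I -> V -> \bar R) : Type := V.

HB.instance Definition _ p := Choice.on (seminorm_topology p).
HB.instance Definition _ p :=
  isSubBaseTopological.Build (seminorm_topology p) (seminorm_subbase p) id.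

Variable p : I -> V -> \bar R.
Local Notation T := (seminorm_topology p).

Lemma nbhs_seminorm_ball i (x y : T) (e : R) : 0 < e ->
  seminorm_ball p i x e y -> nbhs y (seminorm_ball p i x e : set T).
Proof.
move=> e0 xy; rewrite nbhsE; exists (seminorm_ball p i x e : set T) => //.
split => //; exists [set (seminorm_ball p i x e)]; last first.
  by rewrite predeqE => ?; split=> [[_ ->]|] //; exists (seminorm_ball p i x e).
move=> _ ->; exists [fset (seminorm_ball p i x e : set T)]%fset.
  by move=> ?; rewrite inE inE => /eqP->; exists i; exists x; exists e.
rewrite predeqE => z; split=> [zb|zb A]; last by rewrite /= inE => /eqP ->.
by apply: (zb (seminorm_ball p i x e)); rewrite /= inE.
Qed.

Lemma cvg_seminorm (F : set_system T) (y : T) : Filter F ->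
  (forall i x e, 0 < e -> seminorm_ball p i x e y ->
    F (seminorm_ball p i x e)) -> F --> y.
Proof.
move=> FF Fb A; rewrite nbhsE => -[B [oB By] BA].
have [D sD DB] := oB.
apply: (@filterS _ _ _ B) => //.
move: By; rewrite -DB => -[C DC Cy].
apply: (@filterS _ _ _ C); first by move=> z Cz; exists C.
have /sD [E sE EC] := DC; rewrite -EC; apply: filter_bigI => G GE.
have := sE _ GE; rewrite inE => -[i [x [e [e0 Ge]]]].
rewrite Ge; apply: Fb => //.
by move: Cy; rewrite -EC => /(_ _ GE); rewrite Ge.
Qed.

End seminorm_topology.

Section topdual.
Context {K : numFieldType} {V : preTopologicalLmodType K}.

Definition topdual_pred : {pred V -> K^o} :=
  fun u => `[< linear u /\ continuous u >].

Record topdual := TopDual {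
  topdual_fun :> V -> K^o ;
  topdualP : topdual_fun \in topdual_pred }.

HB.instance Definition _ := [isSub for topdual_fun].
HB.instance Definition _ := [Choice of topdual by <:].

Lemma topdual_submod_closed : submod_closed topdual_pred.
Proof.
split.
  apply/asboolP; split; first by move=> a x y; rewrite scaler0 addr0.
  by move=> x; exact: cvg_cst.
move=> a u v /asboolP[lu cu] /asboolP[lv cv]; apply/asboolP; split.
  move=> b x y.
  rewrite -[LHS]/(a *: u (b *: x + y) + v (b *: x + y)) lu lv.
  rewrite -[RHS]/(b *: (a *: u x + v x) + (a *: u y + v y)).
  by rewrite !scalerDr !scalerA [b * a]mulrC addrACA.
move=> x; apply: (@cvgD K K^o).
  by apply: cvgZl_tmp; exact: cu.
exact: cv.
Qed.

HB.instance Definition _ := GRing.isSubmodClosed.Build K _ topdual_pred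
  topdual_submod_closed.
HB.instance Definition _ := [SubChoice_isSubLmodule of topdual by <:].

Lemma topdual_ext (u v : topdual) : u =1 v -> u = v.
Proof. by move=> uv; apply/val_inj/funext. Qed.

Lemma topdualZE (a : K) (u : topdual) x : (a *: u) x = a *: u x.
Proof. by []. Qed.

End topdual.
Arguments topdual {K} V.
Arguments topdual_pred {K} V.

Section smooth_functions.
Variable R : realType.

Definition smoothfun_pred : {pred R -> R[i]^o} :=
  fun f => `[< smooth (f : R -> Rcomplex R) >].

Record smoothfun := SmoothFun {
  smoothfun_fun :> R -> R[i]^o ;
  smoothfunP : smoothfun_fun \in smoothfun_pred }.

HB.instance Definition _ := [isSub for smoothfun_fun].
HB.instance Definition _ := [Choice of smoothfun by <:].

Lemma smoothfun_smooth (f : smoothfun) : smooth (f : R -> Rcomplex R).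
Proof. by have /asboolP := smoothfunP f. Qed.

Lemma smoothfun_submod_closed : submod_closed smoothfun_pred.
Proof.
split; first by apply/asboolP; exact: smooth0.
move=> c f g /asboolP sf /asboolP sg; apply/asboolP.
have H : smooth ((fun s => (c : Rcomplex R) * (f s : Rcomplex R) : Rcomplex R) \+ (g : R -> Rcomplex R)).
  by apply: smoothD => //; exact: smooth_mulc.
exact: H.
Qed.

HB.instance Definition _ := GRing.isSubmodClosed.Build R[i] _ smoothfun_pred
  smoothfun_submod_closed.
HB.instance Definition _ := [SubChoice_isSubLmodule of smoothfun by <:].

(* Uniform convergence of all derivatives on compact sets: topdual smoothfun is
   the space of distributions of compact support. *)
Definition smoothfun_seminorm (nm : nat * nat) (f : smoothfun) : \bar R :=
  ereal_sup [set `|derive1n nm.2 (f : R -> Rcomplex R) t|%:E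
            | t in [set t : R | `|t| <= nm.1%:R]].

HB.instance Definition _ :=
  Topological.copy smoothfun (seminorm_topology smoothfun_seminorm).

Lemma dirac_delta_subproof (tau : R) :
  (fun f : smoothfun => f tau) \in topdual_pred smoothfun.
Proof.
apply/asboolP; split=> // f.
apply/(@cvgrPdist_lt _ R[i]^o _ (nbhs f) (nbhs_filter f)) => /= e e0.
have [d d0 eE] := gt0_complex e0.
have [n tn] : exists n : nat, `|tau| <= n%:R.
  by exists (Num.trunc `|tau|).+1; rewrite ltW// truncnS_gt.
have fB : nbhs f (seminorm_ball (@smoothfun_seminorm) (n, 0%N) f d).
  apply: (@nbhs_seminorm_ball _ _ _ smoothfun_seminorm) => //.
  rewrite /seminorm_ball/= subrr; apply: (@le_lt_trans _ _ 0%E) => //.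
  by apply: ge_ereal_sup => _ [t _ <-]; rewrite /= normr0.
apply: filterS fB => g gfd.
rewrite eE distrC -[ltLHS]Rcomplex_normE ltcR -lte_fin.
apply: le_lt_trans gfd.
by apply: ereal_sup_ubound; exists tau.
Qed.

Definition dirac_delta (tau : R) : topdual smoothfun :=
  TopDual (dirac_delta_subproof tau).

End smooth_functions.

Record weighted_setting (R : realType) := WeightedSetting {
  psi : R -> R ;
  omega : R -> R ;
  psi_smooth : smooth psi ;
  psi_diffeo : exists2 g : R -> R, smooth g & cancel psi g /\ cancel g psi ;
  psi_increasing : {homo psi : x y / x < y} ;
  psi_derive_gt0 : forall t, 0 < derive1 psi t ;
  omega_gt0 : forall t, 0 < omega t ;
  omega_smooth : smooth omega ;
  omega_growth : forall n : nat, exists (C : R) (N : nat),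
    forall t, `|derive1n n omega t| <= C * (1 + `|t|) ^+ N }.

Section weighted_schwartz.
Context {R : realType}.
Variable W : weighted_setting R.
Local Notation psi := (psi W).
Local Notation omega := (omega W).
Implicit Types f g : R -> Rcomplex R.

Definition weighted_derive f : R -> Rcomplex R := fun t =>
  (omega t * derive1 psi t)^-1 *: derive1 (fun s => omega s *: f s) t.

Definition wschwartz_seminorm (km : nat * nat) f : \bar R :=
  ereal_sup (range (fun t =>
    `|(psi t ^+ km.1 * omega t) *: iter km.2 weighted_derive f t|%:E)).

Definition wschwartz_pred : {pred R -> R[i]^o} := fun f =>
  `[< smooth (f : R -> Rcomplex R) /\
      forall km, (wschwartz_seminorm km f < +oo)%E >].

Record wschwartz := WSchwartz {
  wschwartz_fun :> R -> R[i]^o ;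
  wschwartzP : wschwartz_fun \in wschwartz_pred }.

HB.instance Definition _ := [isSub for wschwartz_fun].
HB.instance Definition _ := [Choice of wschwartz by <:].

Lemma omega_psi_neq0 t : omega t * derive1 psi t != 0.
Proof. by rewrite gt_eqF// mulr_gt0// ?omega_gt0// psi_derive_gt0. Qed.

Lemma smooth_weighted_derive f : smooth f -> smooth (weighted_derive f).
Proof.
move=> sf; apply: smooth_scale.
  apply: smoothV; first exact: omega_psi_neq0.
  apply: smoothM; first exact: omega_smooth.
  exact/smooth_derive1/psi_smooth.
exact/smooth_derive1/smooth_scale/sf/omega_smooth.
Qed.

Lemma smooth_iter_weighted_derive m f :
  smooth f -> smooth (iter m weighted_derive f).
Proof. by move=> sf; elim: m => [//|m]; exact: smooth_weighted_derive. Qed.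

Lemma weighted_derive_linear (c : Rcomplex R) f g : smooth f -> smooth g ->
  weighted_derive (fun s => c * f s + g s : Rcomplex R) =
  (fun s => c * weighted_derive f s + weighted_derive g s : Rcomplex R).
Proof.
move=> sf sg; have so : smooth omega by exact: omega_smooth.
apply/funext => t; rewrite /weighted_derive.
have -> : (fun s => omega s *: (c * f s + g s : Rcomplex R)) =
    (fun s => c * (omega s *: f s) : Rcomplex R) \+ (fun s => omega s *: g s).
  apply/funext => s /=; rewrite scalerDr; congr (_ + _).
  by rewrite !Rcomplex_scaleE mulrCA.
rewrite derive1D; last 2 first.
- exact/smooth_derivable/smooth_mulc/smooth_scale.
- exact/smooth_derivable/smooth_scale.
rewrite /= derive1_mulc; last exact/smooth_derivable/smooth_scale.
by rewrite scalerDr; congr (_ + _); rewrite !Rcomplex_scaleE mulrCA.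
Qed.

Lemma iter_weighted_derive_linear m (c : Rcomplex R) f g :
  smooth f -> smooth g ->
  iter m weighted_derive (fun s => c * f s + g s : Rcomplex R) =
  (fun s => c * iter m weighted_derive f s + iter m weighted_derive g s
     : Rcomplex R).
Proof.
move=> sf sg; elim: m => [//|m IHm].
by rewrite iterS IHm weighted_derive_linear//;
  exact: smooth_iter_weighted_derive.
Qed.

Lemma iter_weighted_derive0 m : iter m weighted_derive (cst 0) = cst 0.
Proof.
elim: m => [//|m IHm]; rewrite iterS IHm; apply/funext => t.
rewrite /weighted_derive (_ : (fun s => _) = cst 0).
  by rewrite derive1_cst scaler0.
by apply/funext => s; rewrite scaler0.
Qed.

Lemma wschwartz_smooth (f : wschwartz) : smooth (f : R -> Rcomplex R).
Proof. by have /asboolP[] := wschwartzP f. Qed.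

Lemma wschwartz_seminorm_lty (f : wschwartz) km :
  (wschwartz_seminorm km f < +oo)%E.
Proof. by have /asboolP[_] := wschwartzP f. Qed.

Lemma wschwartz_seminorm_bounded km f :
  (wschwartz_seminorm km f < +oo)%E <->
  exists B : R, forall t,
    `|(psi t ^+ km.1 * omega t) *: iter km.2 weighted_derive f t| <= B.
Proof.
split=> [|[B fB]].
  rewrite /wschwartz_seminorm; set s := ereal_sup _ => soo.
  have us t : (`|(psi t ^+ km.1 * omega t) *:
      iter km.2 weighted_derive f t|%:E <= s)%E.
    by apply: ereal_sup_ubound; exists t.
  have s_fin : s \is a fin_num.
    by rewrite ge0_fin_numE//; apply: le_trans (us 0); rewrite lee_fin.
  by exists (fine s) => t; rewrite -lee_fin fineK.
apply: (@le_lt_trans _ _ B%:E); last exact: ltry.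
by apply: ge_ereal_sup => _ [t _ <-]; rewrite lee_fin.
Qed.

Lemma wschwartz_submod_closed : submod_closed wschwartz_pred.
Proof.
split.
  apply/asboolP; split; first exact: smooth0.
  move=> km; apply/wschwartz_seminorm_bounded; exists 0 => t.
  by rewrite iter_weighted_derive0 scaler0 normr0.
move=> c f g /asboolP[sf bf] /asboolP[sg bg]; apply/asboolP.
pose f' : R -> Rcomplex R := f; pose g' : R -> Rcomplex R := g.
pose c' : Rcomplex R := c.
pose h : R -> Rcomplex R := fun s => c' * f' s + g' s.
suff : smooth h /\ forall km, (wschwartz_seminorm km h < +oo)%E by exact.
split.
  have H : smooth ((fun s => c' * f' s : Rcomplex R) \+ g').
    by apply: smoothD => //; exact: smooth_mulc.
  exact: H.
move=> km; apply/wschwartz_seminorm_bounded.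
have /wschwartz_seminorm_bounded [Bf fB] := bf km.
have /wschwartz_seminorm_bounded [Bg gB] := bg km.
exists (`|c'| * Bf + Bg) => t.
rewrite iter_weighted_derive_linear// scalerDr.
apply: (le_trans (ler_normD _ _)); apply: lerD; last exact: gB.
rewrite Rcomplex_scaleE mulrCA -Rcomplex_scaleE Rcomplex_normrM.
by apply: ler_wpM2l => //; exact: fB.
Qed.

HB.instance Definition _ := GRing.isSubmodClosed.Build R[i] _ wschwartz_pred
  wschwartz_submod_closed.
HB.instance Definition _ := [SubChoice_isSubLmodule of wschwartz by <:].
HB.instance Definition _ := Topological.copy wschwartz
  (seminorm_topology (fun km (f : wschwartz) => wschwartz_seminorm km f)).

End weighted_schwartz.

Section weighted_distributions.
Context {R : realType}.
Variable W : weighted_setting R.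
Local Notation psi := (psi W).
Local Notation omega := (omega W).

Lemma wschwartz_seminorm0 km :
  (wschwartz_seminorm W km (0%R : wschwartz W) <= 0)%E.
Proof.
apply: ge_ereal_sup => _ [t _ <-].
by rewrite iter_weighted_derive0 scaler0 normr0.
Qed.

Lemma nbhs_wschwartz (f : wschwartz W) km (d : R) : 0 < d ->
  nbhs f [set g : wschwartz W | (wschwartz_seminorm W km (g - f)%R < d%:E)%E].
Proof.
move=> d0.
apply: (@nbhs_seminorm_ball _ _ _
  (fun km (f : wschwartz W) => wschwartz_seminorm W km f) km f f d) => //.
rewrite /seminorm_ball /mkset subrr.
by apply: (le_lt_trans (wschwartz_seminorm0 km)).
Qed.

Lemma weighted_delta_subproof (tau : R) :
  (fun f : wschwartz W => f tau) \in topdual_pred (wschwartz W).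
Proof.
apply/asboolP; split=> // f.
apply/(@cvgrPdist_lt _ R[i]^o _ (nbhs f) (nbhs_filter f)) => /= e /gt0_complex.
move=> [d d0 ->]; have o0 := omega_gt0 W tau.
apply: filterS (nbhs_wschwartz f (0, 0)%N (mulr_gt0 o0 d0)) => g gfd.
rewrite distrC -[ltLHS]Rcomplex_normE ltcR -(ltr_pM2l o0) -lte_fin.
apply: le_lt_trans gfd; apply: ereal_sup_ubound; exists tau => //=.
by rewrite expr0 mul1r normrZ gtr0_norm.
Qed.

Definition weighted_delta (tau : R) : topdual (wschwartz W) :=
  TopDual (weighted_delta_subproof tau).

(* omega * D^k phi, which satisfies ewd_(k)' = psi' * ewd_(k+1) *)
Let ewd (f : R -> Rcomplex R) k : R -> Rcomplex R :=
  fun t => omega t *: iter k (weighted_derive W) f t.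

Let smooth_ewd f k : smooth f -> smooth (ewd f k).
Proof.
move=> sf; apply: smooth_scale; first exact: omega_smooth.
exact: smooth_iter_weighted_derive.
Qed.

Let derive1_ewd f k :
  derive1 (ewd f k) = fun t => derive1 psi t *: ewd f k.+1 t.
Proof.
apply/funext => t.
rewrite -[ewd f k.+1 t]/(omega t *: ((omega t * derive1 psi t)^-1 *:
  derive1 (ewd f k) t)).
by rewrite !scalerA [_ * omega t]mulrC mulfV ?omega_psi_neq0// scale1r.
Qed.

Let bounded_on_itv (a : R -> R) n : smooth a ->
  exists2 B : R, 0 <= B & forall t, `|t| <= n%:R -> `|a t| <= B.
Proof.
move=> sa.
have n0 : (- n%:R : R) <= n%:R by rewrite ge0_cp.
have ca : {within `[- n%:R, n%:R], continuous (fun t => `|a t|)}.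
  apply: continuous_subspaceT => t.
  apply: (@continuous_comp _ _ _ a Num.norm).
    exact: smooth_continuous.
  exact: norm_continuous.
have [c _ ac] := EVT_max n0 ca.
by exists `|a c| => // t; rewrite ler_norml => tn; apply: ac; rewrite in_itv.
Qed.

Let ewd_estimate m (a : R -> R) k n : smooth a ->
  exists2 B : R, 0 <= B & forall f d, smooth f ->
    (forall j, (j <= k + m)%N -> forall t, `|ewd f j t| <= d) ->
    forall t, `|t| <= n%:R ->
      `|derive1n m (fun s => a s *: ewd f k s) t| <= B * d.
Proof.
elim: m a k => [|m IHm] a k sa.
  have [B B0 aB] := bounded_on_itv n sa.
  exists B => // f d sf fd t tn /=; rewrite normrZ; apply: ler_pM => //.
    exact: aB.
  by apply: fd; rewrite addn0.
have [B1 B10 H1] := IHm _ k (smooth_derive1 sa).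
have sp : smooth psi by exact: psi_smooth.
have [B2 B20 H2] := IHm _ k.+1 (smoothM sa (smooth_derive1 sp)).
exists (B2 + B1); first exact: addr_ge0.
move=> f d sf fd t tn.
have se j : smooth (ewd f j) by exact: smooth_ewd.
rewrite derive1Sn derive1_scale; [|exact: smooth_derivable..].
rewrite derive1_ewd.
have -> : (fun s => a s *: (derive1 psi s *: ewd f k.+1 s)) =
          (fun s => (a s * derive1 psi s) *: ewd f k.+1 s).
  by apply/funext => s; rewrite scalerA.
rewrite derive1nD; last 2 first.
- exact/smooth_scale/se/smoothM/smooth_derive1.
- exact/smooth_scale/se/smooth_derive1.
rewrite mulrDl; apply: (le_trans (ler_normD _ _)); apply: lerD.
- by apply: H2 => // j jm; apply: fd; rewrite addnS -addSn.
- by apply: H1 => // j jm; apply: fd; rewrite addnS ltnW.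
Qed.

Lemma density_mul_subproof (f : wschwartz W) :
  (fun t => ((omega t ^+ 2 * derive1 psi t)%:C * f t : R[i]^o))
    \in @smoothfun_pred R.
Proof.
apply/asboolP.
have H : smooth (fun t => (omega t ^+ 2 * derive1 psi t) *:
                          (f t : Rcomplex R)).
  apply: smooth_scale; last exact: wschwartz_smooth.
  apply: smoothM; last exact/smooth_derive1/psi_smooth.
  have so : smooth omega by exact: omega_smooth.
  exact: (smoothM so so).
by under eq_fun do rewrite -Rcomplex_scaleE.
Qed.

Definition density_mul (f : wschwartz W) : smoothfun R :=
  SmoothFun (density_mul_subproof f).

Lemma density_mul_linear : linear density_mul.
Proof.
move=> c f g; apply/val_inj/funext => t /=.
rewrite -[LHS]/(_ * (c * f t + g t)) -[RHS]/(c * (_ * f t) + _ * g t).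
by rewrite mulrDr mulrCA.
Qed.

Lemma density_mul_continuous : continuous density_mul.
Proof.
move=> f.
apply: (@cvg_seminorm _ _ _ (@smoothfun_seminorm R) (density_mul x @[x --> f])
  (density_mul f) (fmap_filter _ (nbhs_filter f))).
move=> -[n m] x e e0 fx.
have so : smooth omega by exact: omega_smooth.
have sp' : smooth (derive1 psi) by exact/smooth_derive1/psi_smooth.
have [B B0 fB] := ewd_estimate m 0 n (smoothM so sp').
set r : \bar R := smoothfun_seminorm (n, m) (density_mul f - x)%R in fx.
have r0 : (0 <= r)%E.
  pose w : R -> Rcomplex R := (density_mul f - x)%R.
  apply: (@le_trans _ _ `|derive1n m w 0|%:E); first by rewrite lee_fin.
  by apply: ereal_sup_ubound; exists 0 => //=; rewrite normr0.
have r_fin : r \is a fin_num by rewrite ge0_fin_numE// (lt_trans fx)// ltry.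
have re : fine r < e by rewrite -lte_fin fineK.
pose eta := (e - fine r) / 2.
have eta0 : 0 < eta by rewrite divr_gt0// subr_gt0.
pose d := eta / (B + 1).
have B1 : 0 < B + 1 by rewrite ltr_wpDl.
have d0 : 0 < d by rewrite divr_gt0.
have /filter_forall : forall k : 'I_m.+1, nbhs f
    [set g : wschwartz W |
      (wschwartz_seminorm W (0, k : nat)%N (g - f)%R < d%:E)%E].
  by move=> k; exact: nbhs_wschwartz.
apply: filterS => g gf.
rewrite /= /seminorm_ball /mkset.
apply: (@le_lt_trans _ _ (eta + fine r)%:E); last first.
  by rewrite lte_fin -ltrBrDr ltr_pdivrMr// ltr_pMr ?subr_gt0// ltr1n.
apply: ge_ereal_sup => _ [t /= tn <-]; rewrite lee_fin.
pose h : R -> Rcomplex R := density_mul (g - f).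
pose l : R -> Rcomplex R := (density_mul f - x)%R.
pose q : R -> Rcomplex R := (density_mul g - x)%R.
have : q = h \+ l.
  rewrite /q.
  have -> : (density_mul g - x = density_mul (g - f) + (density_mul f - x))%R.
    have -> : (density_mul (g - f) = density_mul g - density_mul f)%R.
      by rewrite [(g - f)%R]addrC -(scaleN1r f) density_mul_linear scaleN1r addrC.
    by rewrite addrA subrK.
  by [].
move=> qE; change (`|derive1n m q t| <= eta + fine r); rewrite qE derive1nD; [|exact: smoothfun_smooth..].
apply: (le_trans (ler_normD _ _)); apply: lerD; last first.
  by rewrite -lee_fin fineK//; apply: ereal_sup_ubound; exists t.
have -> : h = (fun s => (omega s * derive1 psi s) *: ewd (g - f)%R 0 s).
  apply/funext => s; rewrite /h/= /ewd/= scalerA.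
  rewrite -[LHS]Rcomplex_scaleE; congr (_ *: _).
  by rewrite expr2 mulrAC.
apply: (@le_trans _ _ (B * d)); last first.
  rewrite /d mulrCA ger_pMr// ler_pdivrMr// mul1r.
  by rewrite lerDl.
pose gf' : R -> Rcomplex R := (g - f)%R.
have := fB gf' d (@wschwartz_smooth _ _ (g - f)%R) _ t tn; apply => j jm s.
rewrite -lee_fin; apply/ltW.
apply: le_lt_trans (gf (Ordinal (jm : (j < m.+1)%N))).
by apply: ereal_sup_ubound; exists s => //=; rewrite expr0 mul1r.
Qed.

Lemma of_distribution_subproof (D : topdual (smoothfun R)) :
  (fun f : wschwartz W => D (density_mul f)) \in topdual_pred (wschwartz W).
Proof.
have /asboolP[lD cD] := topdualP D; apply/asboolP; split.
  by move=> c f g; rewrite density_mul_linear lD.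
by move=> f; apply: (continuous_comp (@density_mul_continuous f)); exact: cD.
Qed.

(* The identification of generalized functions with elements of the dual of the
   weighted Schwartz space through the measure omega^2 psi' dt:
   (D, phi)_(psi,omega) = <D, phi omega^2 psi'>. *)
Definition of_distribution (D : topdual (smoothfun R)) :
  topdual (wschwartz W) := TopDual (of_distribution_subproof D).

End weighted_distributions.

(* Main.v *)
Require Import Defs.
From HB Require Import structures.
From mathcomp Require Import all_boot all_order all_algebra.
From mathcomp Require Import finmap complex.
From mathcomp Require Import all_classical all_reals all_analysis.

Set Implicit Arguments.
Unset Strict Implicit.
Unset Printing Implicit Defensive.

Import Order.TTheory GRing.Theory Num.Theory.
Import numFieldNormedType.Exports.

Local Open Scope ring_scope.
Local Open Scope complex_scope.

(** For a test function [phi], both sides depend on the single value [phi tau]: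
    since a point mass sees [phi * omega^2 * psi'] only at [tau], the
    identification through the measure [omega^2 psi' dt] turns the plain delta
    into evaluation at [tau] times the density [omega(tau)^2 psi'(tau)]. This
    density is positive, so dividing by it leaves exactly the evaluation of
    [phi] at [tau]. Elements of the dual that agree on every test function are
    equal. *)

Theorem lemma3p2 (R : realType) (W : weighted_setting R) (tau : R) :
  weighted_delta W tau =
  of_distribution W
    ((1 / (omega W tau ^+ 2 * derive1 (psi W) tau))%:C *: dirac_delta tau).
Proof.
apply: topdual_ext => phi.
set c := omega W tau ^+ 2 * derive1 (psi W) tau.
have c_neq0 : c != 0.
  by rewrite gt_eqF// mulr_gt0 ?exprn_gt0 ?omega_gt0 ?psi_derive_gt0.
change (phi tau = (1 / c)%:C * (c%:C * phi tau) :> R[i]).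
by rewrite mulrA -rmorphM/= divfK// mul1r.
Qed.
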